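(* Let $k$ be a positive integer, $d$ a positive odd integer, $p$ an odd prime with $p>d$, and $i$ an integer with $1\leq i\leq d$. Then in $\mathbb{F}_p$ we have \[ \sum_{\substack{k_{1},\dots,k_{d}\geq1\\ k_{1}+\cdots+k_{d}=k}}2^{k_{i}}H_{p}(k_{1},\dots,k_{d})=\begin{cases}0 & \text{if } p-1\nmid k,\\ -1 & \text{if } p-1\mid k.\end{cases} \]
   Context: For a prime $p$ and integers $k_1,\dots,k_d\geq 1$, define $H_{p}(k_{1},\dots,k_{d}):=\sum_{0<n_{1}<\cdots<n_{d}<p}n_{1}^{-k_{1}}\cdots n_{d}^{-k_{d}}\in\mathbb{F}_{p}:=\mathbb{Z}/p\mathbb{Z}$, where the inverses are taken in $\mathbb{F}_p$. *)

(* Defs.v *)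
From mathcomp Require Import all_boot all_order all_algebra.

Set Implicit Arguments.
Unset Strict Implicit.
Unset Printing Implicit Defensive.

Import GRing.Theory.
Local Open Scope ring_scope.

(* Indices 1..d of the mathematics are the elements 0..d-1 of 'I_d. *)
Definition strictly_increasing (d m : nat) (n : {ffun 'I_d -> 'I_m}) : bool :=
  [forall a : 'I_d, forall b : 'I_d, (a < b)%N ==> (n a < n b)%N].

(* Meaningful for p prime: 'F_p is Z/pZ only in that case. *)
Definition Hp (p d : nat) (k : 'I_d -> nat) : 'F_p :=
  \sum_(n : {ffun 'I_d -> 'I_p}
        | [forall j, 0 < n j]%N && strictly_increasing n)
    \prod_(j < d) ((n j : nat)%:R : 'F_p) ^- k j.

(* Restricting parts to 'I_k.+1 loses nothing, since every part of a
   composition of k is at most k. *)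
Definition is_composition (k d : nat) (c : {ffun 'I_d -> 'I_k.+1}) : bool :=
  [forall j, 1 <= c j]%N && (\sum_(j < d) c j == k)%N.

(* Main.v *)
Require Import Defs.
From mathcomp Require Import all_boot all_order all_algebra.
From mathcomp Require Import ring.

Import GRing.Theory.
Local Open Scope ring_scope.

(** The generating function of the left-hand side over k is
      sum over n_1 < ... < n_d of (2x / (n_i - 2x)) prod_(j <> i) x / (n_j - x).
    Recording the indices before and after n_i by two variables y and z and
    multiplying by prod_(0 < m < p) (m - x) = x^(p-1) - 1 turns it into
      sum_n (x + x n / (n - 2x)) P_n,
      P_n = prod_(m < n) (m - x + y) prod_(m > n) (m - x + z).
    As d is odd, only the part even under (y, z) -> (-y, -z) matters.  The sums
    of the P_n contribute the complete homogeneous polynomial of degree p - 2 in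
    x, y, z, hence x^(p-1) in each degree, while the sum of the
    (n / (n - 2x)) P_n is odd in (y, z).  Its degree in z is at most p - 2, so
    oddness need only be checked at z = y + j for 0 < j < p; there P_n is
    a constant divided by prod_(0 <= l <= j) (n + l - x + y), a p-periodic
    function of n, and the sum has a closed product form.  Hence the generating
    function is x^(p-1) / (x^(p-1) - 1). *)

(* Elementary symmetric polynomial in the u m of degree n - l - i: the i indices
   left out are the ones that matter. *)
Definition cosym {A : comNzRingType} (u : nat -> A) (l n i : nat) : A :=
  (\prod_(l <= m < n) ('X + (u m)%:P))`_i.

(** Elementary symmetric polynomial of degree [i] in the [h m]; unlike in [cosym], [i] counts the
    indices chosen. *)
Definition elsym {A : comNzRingType} (h : nat -> A) (l n i : nat) : A :=
  (\prod_(l <= m < n) (1 + h m *: 'X))`_i.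

(* Sum of prod_j w j (n_j) over n_0 < ... < n_(d-1) < N, by the value of n_(d-1). *)
Fixpoint incsum {A : comNzRingType} (w : nat -> nat -> A) (d N : nat) : A :=
  if d is d'.+1 then \sum_(0 <= m < N) incsum w d' m * w d' m else 1.

(** * Elementary symmetric polynomials on intervals and sums over increasing tuples *)

Section SymmetricSums.
Variable A : comNzRingType.
Implicit Types u h g : nat -> A.

Lemma cosym_id u l i : cosym u l l i = (i == 0)%:R.
Proof. by rewrite /cosym big_geq // coef1. Qed.

Lemma elsym_id h l i : elsym h l l i = (i == 0)%:R.
Proof. by rewrite /elsym big_geq // coef1. Qed.

Lemma cosymS u l n i : (l <= n)%N ->
  cosym u l n.+1 i.+1 = cosym u l n i + u n * cosym u l n i.+1.
Proof.
by move=> ln; rewrite /cosym big_nat_recr //= mulrDr coefD coefMX coefMC mulrC.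
Qed.

Lemma cosymS0 u l n : (l <= n)%N -> cosym u l n.+1 0 = u n * cosym u l n 0.
Proof.
by move=> ln; rewrite /cosym big_nat_recr //= mulrDr coefD coefMX coefMC add0r mulrC.
Qed.

Lemma elsymS h l n i : (l <= n)%N ->
  elsym h l n.+1 i.+1 = elsym h l n i.+1 + elsym h l n i * h n.
Proof.
move=> ln; rewrite /elsym big_nat_recr //= mulrDr mulr1 coefD.
by rewrite -scalerAr coefZ coefMX mulrC.
Qed.

Lemma elsym0 h l n : elsym h l n 0 = 1.
Proof.
rewrite /elsym; elim/big_rec: _ => [|m q _]; first by rewrite coef1.
by rewrite mulrDl mul1r coefD -scalerAl coefZ coefXM /= mulr0 addr0.
Qed.

Lemma cosym0 u l n : cosym u l n 0 = \prod_(l <= m < n) u m.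
Proof.
rewrite /cosym -horner_coef0 horner_prod; apply: eq_bigr => m _.
by rewrite hornerD hornerX hornerC add0r.
Qed.

(** Among the [(a + b).+1] indices left out, [m] is the one with [a] of them below it and [b]
    above. *)
Lemma cosym_split u l n a b : (l <= n)%N ->
  \sum_(l <= m < n) cosym u l m a * cosym u m.+1 n b = cosym u l n (a + b).+1.
Proof.
elim: n a b => [|n IH] a b.
  by rewrite leqn0 => /eqP ->; rewrite big_geq // cosym_id.
rewrite leq_eqVlt => /predU1P[->|]; first by rewrite big_geq // cosym_id.
rewrite ltnS => ln; rewrite big_nat_recr //= cosym_id.
case: b => [|b].
  rewrite mulr1 addn0 cosymS // addrC; congr (_ + _).
  rewrite -[a in cosym u l n a.+1]addn0 -IH // big_distrr /=.
  by apply: eq_big_nat => m /andP[_ mn]; rewrite cosymS0 // mulrCA.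
rewrite mulr0 addr0 cosymS // addnS -IH // -addnS -IH // big_distrr -big_split /=.
apply: eq_big_nat => m /andP[_ mn]; rewrite cosymS // mulrDr.
by rewrite [u n * (_ * _)]mulrCA.
Qed.

(** Each chosen [h m] meets [u m] and yields [x]; the [u m] at the other indices make up [cosym]. *)
Lemma prod_elsym u h x l n i : (l <= n)%N ->
    (forall m, (l <= m < n)%N -> u m * h m = x) ->
  (\prod_(l <= m < n) u m) * elsym h l n i = x ^+ i * cosym u l n i.
Proof.
elim: n i => [|n IH] i.
  by rewrite leqn0 => /eqP -> _; rewrite big_geq // elsym_id cosym_id; case: i => [|i] /=;
    rewrite ?mul1r ?mulr1 ?mulr0.
rewrite leq_eqVlt => /predU1P[-> _|].
  by rewrite big_geq // elsym_id cosym_id; case: i => [|i] /=;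
    rewrite ?mul1r ?mulr1 ?mulr0.
rewrite ltnS => ln uh; case: i => [|i].
  by rewrite elsym0 cosym0 mul1r mulr1.
have {}IH j : (\prod_(l <= m < n) u m) * elsym h l n j = x ^+ j * cosym u l n j.
  by apply: IH => // m /andP[lm mn]; apply: uh; rewrite lm leqW.
have un : u n * h n = x by apply: uh; rewrite ln /=.
rewrite big_nat_recr //= elsymS // cosymS // !mulrDr addrC; congr (_ + _).
  by rewrite mulrACA IH un exprSr; ring.
by rewrite mulrAC IH; ring.
Qed.

Lemma elsym_drop0 h n i : h 0 = 0 -> (0 < n)%N -> elsym h 0 n i = elsym h 1 n i.
Proof.
by move=> h0 n0; rewrite /elsym big_ltn // h0 scale0r addr0 mul1r.
Qed.

Lemma incsum_const (w : nat -> nat -> A) h d N :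
  (forall j m, (j < d)%N -> w j m = h m) -> incsum w d N = elsym h 0 N d.
Proof.
elim: d N => [|d IH] N wh /=; first by rewrite elsym0.
have {}IH M : incsum w d M = elsym h 0 M d.
  by apply: IH => j m jd; apply: wh; rewrite ltnW.
elim: N => [|N IHN]; first by rewrite big_geq // elsym_id.
by rewrite big_nat_recr //= IHN IH wh // elsymS.
Qed.

(** Fixing the value [n] at the marked position leaves [i] values below [n] and [b] above; the
    induction on [b] peels off the largest value. *)
Lemma incsum_mark (w : nat -> nat -> A) h g i b N :
    (forall m, w i m = g m) -> (forall j m, j != i -> w j m = h m) ->
  incsum w (i + b.+1) N
  = \sum_(0 <= n < N) elsym h 0 n i * g n * elsym h n.+1 N b.
Proof.
move=> wg wh; elim: b N => [|b IH] N.
  rewrite addn1 /=; apply: eq_bigr => n _.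
  rewrite elsym0 mulr1 wg (@incsum_const w h) // => j m ji.
  by apply: wh; rewrite ltn_eqF.
rewrite addnS /=; elim: N => [|N IHN]; first by rewrite !big_geq.
rewrite big_nat_recr //= IHN [in RHS]big_nat_recr //= elsym_id mulr0 addr0.
rewrite IH wh ?gtn_eqF // -?addSnnS ?leq_addr // big_distrl -big_split /=.
by apply: eq_big_nat => n /andP[_ nN]; rewrite elsymS // mulrDr mulrA.
Qed.

Lemma incsum_ffun (w : nat -> nat -> A) (p d N : nat) : (N <= p)%N ->
  \sum_(n : {ffun 'I_d -> 'I_p} |
         strictly_increasing n && [forall j, n j < N]%N)
     \prod_(j < d) w j (n j) = incsum w d N.
Proof.
elim: d N => [|d IH] N Np /=.
  pose f0 := [ffun j : 'I_0 => False_rect 'I_p (notF (ltn_ord j))].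
  rewrite (big_pred1 f0) ?big_ord0 // => f /=.
  have -> : f = f0 by apply/ffunP => -[].
  by rewrite eqxx; apply/andP; split; apply/forallP => -[].
case: p Np IH => [|p] Np IH.
  move: Np; rewrite leqn0 => /eqP ->; rewrite big_geq // big_pred0 // => f.
  by case: (f ord0).
(* Sort by the last value [m], which is the largest; below, [ext] appends it to a shorter tuple and
   [res] drops it. *)
rewrite (partition_big (fun n : {ffun _ -> _} => n ord_max : 'I_p.+1)
          (fun m : 'I_p.+1 => m < N)%N) /=; last first.
  by move=> f /andP[_ /forallP].
rewrite big_mkord (big_ord_widen p.+1 (fun m => incsum w d m * w d m)) //.
apply: eq_bigr => m mN; rewrite -IH ?(ltnW (leq_trans mN Np)) // big_distrl /=.
pose ext (f : {ffun 'I_d -> 'I_p.+1}) : {ffun 'I_d.+1 -> 'I_p.+1} :=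
  [ffun j => if unlift ord_max j is Some j' then f j' else m].
pose res (f : {ffun 'I_d.+1 -> 'I_p.+1}) : {ffun 'I_d -> 'I_p.+1} :=
  [ffun j => f (lift ord_max j)].
have extl f j : ext f (lift ord_max j) = f j by rewrite ffunE liftK.
have extm f : ext f ord_max = m by rewrite ffunE unlift_none.
rewrite (reindex_onto ext res) /=; last first.
  move=> f /andP[_ /eqP fm]; apply/ffunP => j; rewrite ffunE.
  by case: unliftP => [j'|] ->; rewrite ?ffunE.
apply: eq_big => [f|f _]; last first.
  rewrite big_ord_recr /= extm; congr (_ * _); apply: eq_bigr => j _.
  by rewrite -(extl f); congr (w _ (ext f _)); apply: val_inj; exact/esym/(lift_max j).
have -> : res (ext f) == f by apply/eqP/ffunP => j; rewrite ffunE extl.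
rewrite extm eqxx !andbT; apply/andP/andP => -[/forallP inc /forallP bnd].
  split; apply/forallP => a.
    apply/forallP => b; apply/implyP => ab.
    have /forallP/(_ (lift ord_max b)) := inc (lift ord_max a).
    by rewrite !extl !lift_max ab.
  have /forallP/(_ ord_max) := inc (lift ord_max a).
  by rewrite extl extm lift_max /= ltn_ord.
split; apply/forallP => a; last first.
  by case: (unliftP ord_max a) => [a'|] ->; rewrite ?extl ?extm // (ltn_trans (bnd _)).
apply/forallP => b; apply/implyP.
case: (unliftP ord_max a) => [a'|] ->; case: (unliftP ord_max b) => [b'|] ->;
  rewrite ?extl ?extm ?lift_max //=.
- by move=> ab; have /forallP/(_ b')/implyP := inc a'; apply.
- by move=> db; have := ltn_ord b'; rewrite ltnNge (ltnW db).
- by rewrite ltnn.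
Qed.

Lemma coef_prod_CsubX u l n i :
  (\prod_(l <= m < n) ((u m)%:P - 'X))`_i = (-1) ^+ i * cosym u l n i.
Proof.
have -> : \prod_(l <= m < n) ((u m)%:P - 'X)
          = (\prod_(l <= m < n) ('X + (u m)%:P)) \Po - 'X.
  rewrite (rmorph_prod (comp_poly (- 'X))); apply: eq_bigr => m _.
  by rewrite rmorphD /= comp_polyX comp_polyC addrC.
rewrite /cosym -scaleN1r.
elim/poly_ind: (\prod_(l <= m < n) _) i => [|q c IH] i.
  by rewrite comp_poly0 coef0 mulr0.
rewrite comp_poly_MXaddC coefD coefC -scalerAr coefZ coefMX coefD coefMX coefC.
case: i => [|i]; rewrite /= ?mulr0 ?mul1r // IH exprS.
by rewrite !addr0 mulrA.
Qed.
End SymmetricSums.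

Lemma cosym_morph (A B : comNzRingType) (f : {rmorphism A -> B}) (u : nat -> A)
    (v : nat -> B) l n i :
  (forall m, v m = f (u m)) -> cosym v l n i = f (cosym u l n i).
Proof.
move=> vu; rewrite /cosym -coef_map rmorph_prod.
under [in RHS]eq_bigr => m _ do rewrite rmorphD /= map_polyX map_polyC /= -vu.
by [].
Qed.

Lemma elsym_morph (A B : comNzRingType) (f : {rmorphism A -> B}) (h : nat -> A)
    l n i : f (elsym h l n i) = elsym (fun m => f (h m)) l n i.
Proof.
rewrite /elsym -coef_map rmorph_prod.
under eq_bigr => m _ do rewrite rmorphD rmorph1 /= map_polyZ map_polyX.
by [].
Qed.

(** * Products and sums over a full period in characteristic [p] *)

Section PrimeCharacteristic.
Variables (F : fieldType) (p : nat).
Hypothesis pF : p \in [pchar F].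
Implicit Types a c x y t : F.

Let p_prime : prime p := pcharf_prime pF.
Let p_gt0 : (0 < p)%N := prime_gt0 p_prime.

Lemma natr_pchar_inj m n : (m < p)%N -> (n < p)%N ->
  m%:R = n%:R :> F -> m = n.
Proof.
move=> mp np; wlog mn : m n mp np / (m <= n)%N.
  move=> H; case/orP: (leq_total m n) => mn e; first exact: H.
  by apply/esym/H.
move/eqP; rewrite eq_sym -subr_eq0 -natrB // -(dvdn_pcharf pF) => pd.
apply/eqP; rewrite eqn_leq mn -subn_eq0 /=.
case: posnP => // nm0; have := dvdn_leq nm0 pd.
by rewrite leqNgt (leq_ltn_trans (leq_subr _ _) np).
Qed.

Lemma natr_pchar_neq0 n : (0 < n < p)%N -> n%:R != 0 :> F.
Proof.
case/andP=> n0 np; apply/eqP => /(@natr_pchar_inj n 0 np p_gt0) n0'.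
by rewrite n0' in n0.
Qed.

Lemma natr_pchar_exp n : n%:R ^+ p = n%:R :> F.
Proof. exact: (pFrobenius_aut_nat pF). Qed.

Lemma natr_pchar_sub n : (n <= p)%N -> (p - n)%:R = - n%:R :> F.
Proof. by move=> np; rewrite natrB // (pcharf0 pF) sub0r. Qed.

(** By Fermat, the [p] distinct residues are roots of a monic polynomial of degree [p]. *)
Lemma prod_XsubC_natr :
  \prod_(0 <= m < p) ('X - m%:R%:P) = 'X^p - 'X :> {poly F}.
Proof.
have sX : (size (- 'X : {poly F}) < size ('X^p : {poly F}))%N.
  by rewrite size_polyN size_polyX size_polyXn ltnS prime_gt1.
have lc : lead_coef ('X^p - 'X : {poly F}) = 1.
  by rewrite lead_coefDl // lead_coefXn.
pose rs := [seq m%:R : F | m <- iota 0 p].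
have := @all_roots_prod_XsubC F ('X^p - 'X) rs.
rewrite size_polyDl // size_polyXn size_map size_iota lc scale1r => -> //.
- by rewrite big_map /index_iota subn0.
- apply/allP => _ /mapP[m _ ->].
  by rewrite /root !hornerE natr_pchar_exp subrr.
- rewrite uniq_rootsE map_inj_in_uniq ?iota_uniq // => m n.
  by rewrite !mem_iota !add0n /= => mp np; apply: natr_pchar_inj.
Qed.

Hypothesis p_odd : odd p.

(** Evaluation of ['X^p - 'X] at [t], with sign [(-1)^p = -1]. The morphism [f] lets [t] live in an
    extension such as a polynomial ring. *)
Lemma prod_natrB (B : comNzRingType) (f : {rmorphism F -> B}) (t : B) :
  \prod_(0 <= m < p) (m%:R - t) = t - t ^+ p.
Proof.
have /(congr1 (fun q => (map_poly f q).[t])) := prod_XsubC_natr.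
rewrite rmorph_prod horner_prod rmorphB /= map_polyXn map_polyX !hornerE => H.
rewrite -[RHS]opprB -H -[RHS]mulN1r.
have -> : -1 = \prod_(0 <= m < p) (-1 : B).
  by rewrite prodr_const_nat subn0 -signr_odd p_odd.
rewrite -big_split; apply: eq_bigr => m _ /=.
by rewrite rmorphB /= map_polyX map_polyC !hornerE /= rmorph_nat; ring.
Qed.

Lemma prod1_natrB (B : comNzRingType) (f : {rmorphism F -> B}) (t : B) :
  - t * \prod_(1 <= m < p) (m%:R - t) = t - t ^+ p.
Proof. by rewrite -(prod_natrB _ f) [RHS]big_ltn // sub0r. Qed.

Let id_prod t : \prod_(0 <= m < p) (m%:R - t) = t - t ^+ p.
Proof. exact: (prod_natrB _ idfun). Qed.

Lemma prod_XaddC_natrB x :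
  \prod_(0 <= m < p) ('X + (m%:R - x)%:P) = 'X^p - 'X + (x - x ^+ p)%:P.
Proof.
have := prod_natrB _ (@polyC F) (x%:P - 'X).
under eq_bigr => m _.
  rewrite (_ : _ - _ = 'X + (m%:R - x)%:P); last first.
    by rewrite polyCB polyC_natr; ring.
  over.
move=> ->; have pP : p \in [pchar {poly F}] by exact: (rmorph_pchar (@polyC F)).
rewrite -[(x%:P - 'X) ^+ p]/(pFrobenius_aut pP _).
rewrite pFrobenius_autB_comm; last exact: mulrC.
by rewrite !pFrobenius_autE polyCB rmorphXn /=; ring.
Qed.

(** Dividing the product over a full period by its factor at 0 gives [(X^p - x^p)/(X - x) - 1];
    [0 < r] avoids the constant [-1]. *)
Lemma cosym_natrB x r : (0 < r < p)%N ->
  cosym (fun m => m%:R - x) 1 p r = x ^+ (p.-1 - r).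
Proof.
case/andP=> r0 rp; rewrite /cosym.
suff -> : \prod_(1 <= m < p) ('X + (m%:R - x)%:P)
          = \sum_(i < p) x%:P ^+ (p.-1 - i) * 'X^i - 1.
  rewrite coefB coef1 gtn_eqF // subr0 coef_sum (bigD1 (Ordinal rp)) //=.
  rewrite -rmorphXn coefCM coefXn eqxx mulr1 big1 ?addr0 // => i ir.
  rewrite -rmorphXn coefCM coefXn eq_sym -[r]/(val (Ordinal rp)).
  by rewrite (inj_eq val_inj) (negPf ir) mulr0.
apply: (@mulfI _ ('X - x%:P)); first by rewrite polyXsubC_eq0.
have := prod_XaddC_natrB x; rewrite big_ltn // sub0r polyCN => ->.
rewrite mulrBr mulr1 -[X in _ = X * _ - _]opprB mulNr -subrXX.
by rewrite polyCB rmorphXn /=; ring.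
Qed.

(** A logarithmic derivative: times the full product, the sum becomes the linear coefficient of
    [X^p - X + (t - t^p)], which is -1. *)
Lemma sum_inv_natrB t : (forall n, n%:R != t) ->
  \sum_(0 <= n < p) (n%:R - t)^-1 = - (t - t ^+ p)^-1.
Proof.
move=> tn; have nt n : n%:R - t != 0 by rewrite subr_eq0.
have pi0 : t - t ^+ p != 0.
  by rewrite -id_prod prodf_seq_neq0; apply/allP => n _; rewrite nt.
apply: (mulfI pi0); rewrite mulrN mulfV // big_distrr /=.
have := @cosym_split F (fun m => m%:R - t) 0 p 0 0 isT.
have -> : cosym (fun m => m%:R - t) 0 p 1 = -1.
  rewrite /cosym prod_XaddC_natrB !coefE ltn_eqF ?prime_gt1 //=.
  by rewrite sub0r addr0.
move=> <-; apply: eq_big_nat => n /andP[_ np]; rewrite !cosym0 -id_prod.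
rewrite (@big_cat_nat _ _ _ n) ?(ltnW np) //= [\prod_(n <= i < p) _]big_ltn //.
by field; apply: nt.
Qed.

(** Reciprocal rising factorial of [n - a]; it has period [p] in [n]. *)
Definition invprod a j n : F := (\prod_(0 <= l < j) ((n + l)%:R - a))^-1.

Lemma prod_natrB_neq0 a j n : (forall m, m%:R != a) ->
  \prod_(0 <= l < j) ((n + l)%:R - a) != 0.
Proof.
move=> na; rewrite prodf_seq_neq0; apply/allP => l _.
by rewrite subr_eq0 na.
Qed.

(** Since [j * invprod a j.+1 n = invprod a j n - invprod a j n.+1], the sum telescopes over a full
    period, and [j] is invertible. *)
Lemma sum_invprod a j : (forall n, n%:R != a) -> (0 < j < p)%N ->
  \sum_(0 <= n < p) invprod a j.+1 n = 0.
Proof.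
move=> na jp; have nz n : n%:R - a != 0 by rewrite subr_eq0.
apply: (mulfI (natr_pchar_neq0 _ jp)); rewrite mulr0 big_distrr /=.
under eq_bigr => n _.
  have -> : j%:R * invprod a j.+1 n = - (invprod a j n.+1 - invprod a j n).
    have e : \prod_(0 <= l < j) ((n + l)%:R - a) * ((n + j)%:R - a)
             = (n%:R - a) * \prod_(0 <= l < j) ((n.+1 + l)%:R - a).
      rewrite -[LHS]big_nat_recr //= big_nat_recl // addn0; congr (_ * _).
      by apply: eq_bigr => l _; rewrite addSnnS.
    rewrite /invprod big_nat_recr //=.
    have -> : \prod_(0 <= l < j) ((n.+1 + l)%:R - a)
       = \prod_(0 <= l < j) ((n + l)%:R - a) * ((n + j)%:R - a) / (n%:R - a).
      by rewrite e mulrAC mulfV // mul1r.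
    rewrite natrD; field.
    by rewrite (prod_natrB_neq0 _ _ _ na) -natrD !nz.
  over.
rewrite sumrN telescope_sumr // /invprod.
rewrite [X in X^-1 - _](eq_bigr (fun l => (0 + l)%:R - a)) ?subrr ?oppr0 //.
by move=> l _; rewrite natrD (pcharf0 pF) !add0r add0n.
Qed.

(** Induction on [j], starting from the partial fractions of [1/((n - c)(n - a))] and
    [sum_inv_natrB]. *)
Lemma sum_invprod_natrB a c j :
    (forall n, n%:R != a) -> (forall n, n%:R != c) ->
    (forall n, n%:R != a - c) -> (j < p)%N ->
  \sum_(0 <= n < p) (n%:R - c)^-1 * invprod a j.+1 n
  = (c - a - (c - a) ^+ p) / ((a - a ^+ p) * (c - c ^+ p))
    / \prod_(0 <= l < j.+1) (c - a + l%:R).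
Proof.
move=> na nc nac.
have za n : n%:R - a != 0 by rewrite subr_eq0.
have zc n : n%:R - c != 0 by rewrite subr_eq0.
have zac n : c - a + n%:R != 0.
  by apply: contra (nac n) => /eqP h; rewrite eq_sym -subr_eq0 -oppr_eq0 -h; apply/eqP; ring.
have pa : a - a ^+ p != 0.
  by rewrite -id_prod prodf_seq_neq0; apply/allP => n _; rewrite za.
have pc : c - c ^+ p != 0.
  by rewrite -id_prod prodf_seq_neq0; apply/allP => n _; rewrite zc.
have ca0 : c - a != 0 by have := zac 0%N; rewrite addr0.
elim: j => [|j IH] jp.
  rewrite big_nat1 addr0.
  under eq_bigr => n _.
    rewrite /invprod big_nat1 addn0.
    rewrite (_ : _ * _ = ((n%:R - c)^-1 - (n%:R - a)^-1) / (c - a)); last first.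
      by field; rewrite za zc ca0.
    over.
  rewrite -big_distrl /= sumrB !sum_inv_natrB //.
  rewrite -[(c - a) ^+ p]/(pFrobenius_aut pF _).
  rewrite pFrobenius_autB_comm; last exact: mulrC.
  rewrite !pFrobenius_autE; field.
  by rewrite ca0 pa pc.
rewrite [in RHS]big_nat_recr //= [(\prod_(_ <= _ < _) _ * _)^-1]invfM mulrA -IH ?(ltnW jp) //.
(* Subtracting this vanishing sum makes the identity termwise: [(n + j + 1 - a) - (n - c)] is the
   new factor [c - a + (j + 1)]. *)
rewrite -[X in _ = X / _]subr0 -[X in _ = (_ - X) / _](@sum_invprod a j.+1) //.
rewrite -sumrB big_distrl /=.
apply: eq_bigr => n _; rewrite /invprod.
rewrite [\prod_(0 <= l < j.+2) _]big_nat_recr //= natrD; field.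
by rewrite nat1r zac -natrD za prod_natrB_neq0 // zc.
Qed.

(** The case [z = y + j] of the overview, with [a = x - y] and [c = 2x]. The two products run over
    [0 < l < p + j] except [n <= l <= n + j], so each term is a constant times
    [invprod a j.+1 n]. *)
Lemma sum_prod_shift a c j :
    (forall n, n%:R != a) -> (forall n, n%:R != c) ->
    (forall n, n%:R != a - c) -> (0 < j < p)%N ->
  \sum_(1 <= n < p) n%:R / (n%:R - c) *
    (\prod_(1 <= m < n) (m%:R - a) * \prod_(n.+1 <= m < p) ((m + j)%:R - a))
  = - (c / (c - c ^+ p)) *
    (\prod_(1 <= l < j) (l%:R - a) * \prod_(j.+1 <= l < p) (c - a + l%:R)).
Proof.
move=> na nc nac j0p; have /andP[j0 jp] := j0p.
have za n : n%:R - a != 0 by rewrite subr_eq0.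
have zc n : n%:R - c != 0 by rewrite subr_eq0.
have pa : a - a ^+ p != 0.
  by rewrite -id_prod prodf_seq_neq0; apply/allP => n _; rewrite za.
have pc : c - c ^+ p != 0.
  by rewrite -id_prod prodf_seq_neq0; apply/allP => n _; rewrite zc.
have pca : \prod_(0 <= l < p) (c - a + l%:R) = - (c - a - (c - a) ^+ p).
  transitivity (\prod_(0 <= l < p) (l%:R - (a - c))).
    by apply: eq_bigr => l _; ring.
  rewrite id_prod -[a - c]opprB exprNn -signr_odd p_odd; ring.
have zD k : \prod_(0 <= l < k) (c - a + l%:R) != 0.
  rewrite prodf_seq_neq0; apply/allP => l _ /=.
  apply: contra (nac l) => /eqP h; rewrite eq_sym -subr_eq0 -oppr_eq0 -h.
  by apply/eqP; ring.
set E := \prod_(1 <= l < p + j) (l%:R - a).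
have E1 n : (0 < n < p)%N ->
    \prod_(1 <= m < n) (m%:R - a) * \prod_(n.+1 <= m < p) ((m + j)%:R - a)
    = E * invprod a j.+1 n.
  case/andP=> n0 np; rewrite /E /invprod.
  rewrite (@big_cat_nat _ _ _ n 1 (p + j)) ?(leq_trans (ltnW np) (leq_addr _ _)) //=.
  rewrite (@big_cat_nat _ _ _ (n + j.+1) n (p + j)) ?leq_addr //=; last first.
    by rewrite addnS -addSn leq_add2r.
  have -> : \prod_(n <= l < n + j.+1) (l%:R - a)
            = \prod_(0 <= l < j.+1) ((n + l)%:R - a).
    rewrite -{1}[n]add0n big_addn addKn.
    by apply: eq_bigr => l _; rewrite addnC.
  have -> : \prod_(n + j.+1 <= l < p + j) (l%:R - a)
            = \prod_(n.+1 <= m < p) ((m + j)%:R - a).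
    by rewrite addnS -addSn big_addn addnK.
  by field; rewrite prod_natrB_neq0.
(* The factors from [p] to [p + j - 1] repeat those from 0 to [j - 1]; the one at [p] completes a
   full period. *)
have E2 : E = (a - a ^+ p) * \prod_(1 <= l < j) (l%:R - a).
  rewrite /E (@big_cat_nat _ _ _ p) ?leq_addr //=.
  rewrite -{2}[p]add0n big_addn addKn [\prod_(0 <= i < j) _]big_ltn //.
  rewrite add0n (pcharf0 pF) sub0r.
  rewrite mulrA [_ * - a]mulrC (prod1_natrB _ idfun); congr (_ * _).
  by apply: eq_bigr => l _; rewrite natrD (pcharf0 pF) addr0.
(* Write [n/(n - c) = 1 + c/(n - c)]; this is 0 at [n = 0], so the sum extends to a full period. *)
transitivity (\sum_(0 <= n < p) E *
   (invprod a j.+1 n + c * ((n%:R - c)^-1 * invprod a j.+1 n))).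
  have c0 : c != 0 by have := nc 0%N; rewrite eq_sym.
  rewrite [in RHS]big_ltn // [X in _ = X + _](_ : _ = 0) ?add0r; last first.
    by field; rewrite oppr_eq0.
  apply: eq_big_nat => n n0p; rewrite E1 //; field; exact: zc.
rewrite -big_distrr /= big_split /= -big_distrr /= sum_invprod // add0r.
rewrite sum_invprod_natrB // E2.
have := pca; rewrite (@big_cat_nat _ _ _ j.+1) //= => pca'.
have -> : c - a - (c - a) ^+ p = - (\prod_(0 <= i < j.+1) (c - a + i%:R) *
         \prod_(j.+1 <= i < p) (c - a + i%:R)) by rewrite pca' opprK.
by field; rewrite pa pc zD.
Qed.

End PrimeCharacteristic.

(** * The reflection taking [a] to [c - a] and [j] to [p - j] *)

Section Reflection.
Variables (F : fieldType) (p : nat).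
Hypothesis pF : p \in [pchar F].
Hypothesis p_odd : odd p.
Implicit Types a c x y t : F.

Let p_prime : prime p := pcharf_prime pF.
Let p_gt0 : (0 < p)%N := prime_gt0 p_prime.

Lemma natr_neqN t : (forall n, n%:R != t) -> forall n, n%:R != - t.
Proof.
move=> nt n; apply: contra (nt (n * p.-1)%N) => /eqP e.
rewrite natrM -subn1 natrB // (pcharf0 pF) sub0r mulrN1 e opprK.
exact: eqxx.
Qed.

(** Replace [l] by [p - l], which is [-l] in [F]. *)
Lemma prod_rev_natrD t j : (j <= p)%N ->
  \prod_(j.+1 <= l < p) (t + l%:R)
  = (-1) ^+ (p - j).-1 * \prod_(1 <= l < p - j) (l%:R - t).
Proof.
move=> jp; rewrite -[in LHS]add1n big_addn big_nat_rev /=.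
have -> : (-1) ^+ (p - j).-1 = \prod_(1 <= l < p - j) (-1 : F).
  by rewrite prodr_const_nat subn1.
rewrite -big_split; apply: eq_big_nat => l /andP[_ lj] /=.
rewrite add1n subSS.
have -> : (p - j - l + j = p - l)%N.
  by rewrite subnAC subnK // leq_subRL ?(leq_trans (ltnW lj)) ?leq_subr //
     addnC -leq_subRL // ltnW.
rewrite natr_pchar_sub // ?(leq_trans (ltnW lj)) ?leq_subr //; ring.
Qed.

(** Reversal swaps the two products of the closed form. The signs [(-1)^(p - j - 1)] and
    [(-1)^(j - 1)] are opposite because [p] is odd, so the two sums cancel. *)
Lemma sum_prod_shift_reflect a c j :
    (forall n, n%:R != a) -> (forall n, n%:R != c) ->
    (forall n, n%:R != a - c) -> (0 < j < p)%N ->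
  \sum_(1 <= n < p) n%:R / (n%:R - c) *
    (\prod_(1 <= m < n) (m%:R - a) * \prod_(n.+1 <= m < p) ((m + j)%:R - a))
  + \sum_(1 <= n < p) n%:R / (n%:R - c) *
    (\prod_(1 <= m < n) (m%:R - (c - a)) *
     \prod_(n.+1 <= m < p) ((m + (p - j))%:R - (c - a))) = 0.
Proof.
move=> na nc nac j0p; have /andP[j0 jp] := j0p.
have nca n : n%:R != c - a by rewrite -opprB natr_neqN.
have ncac n : n%:R != c - a - c by rewrite addrAC subrr add0r natr_neqN.
have pj : (0 < p - j < p)%N by rewrite subn_gt0 jp ltn_subrL j0 p_gt0.
rewrite !sum_prod_shift // subKr (prod_rev_natrD (c - a)) ?(ltnW jp) //.
rewrite prod_rev_natrD ?leq_subr // subKn ?(ltnW jp) //.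
have -> : (-1) ^+ (p - j).-1 = - (-1) ^+ j.-1 :> F.
  rewrite -signr_odd -[in RHS]signr_odd -[(p - j).-1]subn1 -[j.-1]subn1.
  rewrite !oddB ?subn_gt0 ?(ltnW jp) // p_odd.
  by case: (odd j); rewrite /= ?expr0 ?expr1 ?opprK.
ring.
Qed.

End Reflection.

(** * Parity cancellation in the marked sum *)

Lemma natr2_pchar_neq0 (F : fieldType) p :
  p \in [pchar F] -> odd p -> 2%:R != 0 :> F.
Proof.
move=> pF p_odd; apply: (natr_pchar_neq0 _ _ pF); rewrite /= (ltn_neqAle 2).
rewrite (prime_gt1 (pcharf_prime pF)).
by rewrite andbT; apply: contraTneq p_odd => <-.
Qed.

Lemma size_prod_linear (R : nzRingType) (f : nat -> {poly R}) l n :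
  (forall m, size (f m) <= 2)%N ->
  (size (\prod_(l <= m < n) f m)%R <= (n - l).+1)%N.
Proof.
move=> sf; elim: n => [|n IH]; first by rewrite big_geq // size_poly1.
have [nl|ln] := ltnP n l; first by rewrite big_geq ?size_poly1.
rewrite big_nat_recr //= subSn //; apply: leq_trans (size_polyMleq _ _) _.
rewrite -subn1 leq_subLR add1n -addn2; exact: leq_add.
Qed.

(** The sum is the coefficient of [y^i z^b] in the sum of the [n/(n - 2x) P_n], which is odd in
    [(y, z)]. *)
Lemma sum_cosym_even (F : fieldType) (p : nat) (x : F) (i b : nat) :
    p \in [pchar F] -> odd p -> (forall n, n%:R != x *+ 2) -> ~~ odd (i + b) ->
  \sum_(1 <= n < p) n%:R / (n%:R - x *+ 2) *
    (cosym (fun m => m%:R - x) 1 n i * cosym (fun m => m%:R - x) n.+1 p b) = 0.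
Proof.
move=> pF p_odd n2x ib; set u := fun m => m%:R - x.
have p_gt0 : (0 < p)%N := prime_gt0 (pcharf_prime pF).
(* y is the variable of {poly F}, so that x - y is transcendental over F. *)
pose K := {fraction {poly F}}.
have [io ioE] : exists io : {rmorphism F -> K}, forall e, io e = tofrac e%:P.
  by exists (@tofrac {poly F} \o @polyC F)%FUN.
pose y : K := tofrac ('X : {poly F}).
have pK : p \in [pchar K] by exact: (rmorph_pchar io).
pose c : nat -> F := fun n => n%:R / (n%:R - x *+ 2).
pose T1 n : {poly F} := \prod_(1 <= m < n) ('X + (u m)%:P).
pose T2 n : {poly F} := \prod_(1 <= m < n) ((u m)%:P - 'X).
pose P1 n : {poly K} := \prod_(n.+1 <= m < p) ('X + (io (u m))%:P).
pose P2 n : {poly K} := \prod_(n.+1 <= m < p) ((io (u m))%:P - 'X).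
(* The sum plus its image under [(y, z) -> (-y, -z)], as a polynomial in [z] over [K]. *)
pose Psi : {poly K} := \sum_(1 <= n < p) io (c n) *:
   (tofrac (T1 n) *: P1 n + tofrac (T2 n) *: P2 n).
have frac_neq n e : n%:R != tofrac (e%:P - 'X) :> K.
  rewrite -(rmorph_nat (@tofrac {poly F})) tofrac_eq -polyC_natr.
  apply/eqP => /(congr1 (fun q : {poly F} => size q)).
  rewrite -[e%:P - _]opprB size_polyN size_XsubC => sz.
  by have := size_polyC_leq1 (n%:R : F); rewrite sz.
have Psi_root j : (0 < j < p)%N -> root Psi (y + j%:R).
  (* Then [d - a = x + y], so the reflected sum is the one with [-y] and [-z = -y - j]. *)
  move=> j0p; pose a := io x - y; pose d := io x *+ 2.
  have aE : a = tofrac (x%:P - 'X) by rewrite /a ioE rmorphB.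
  have na n : n%:R != a by rewrite aE frac_neq.
  have nd n : n%:R != d by rewrite /d -rmorphMn -[n%:R](rmorph_nat io) fmorph_eq.
  have nad n : n%:R != a - d.
    have -> : a - d = tofrac ((- x)%:P - 'X).
      by rewrite rmorphB /= -ioE -/y rmorphN /a /d; ring.
    exact: frac_neq.
  have H := @sum_prod_shift_reflect K p pK p_odd a d j na nd nad j0p.
  apply/eqP; rewrite -[RHS]H /Psi horner_sum -big_split /=.
  apply: eq_bigr => n _; rewrite hornerZ hornerD !hornerZ -mulrDr.
  have -> : io (c n) = n%:R / (n%:R - d).
    by rewrite /c fmorph_div (rmorphB io) (rmorph_nat io) (rmorphMn io).
  congr (_ * (_ * _ + _ * _)).
  - rewrite rmorph_prod; apply: eq_bigr => m _.
    by rewrite rmorphD /= -/y -ioE rmorphB rmorph_nat /a; ring.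
  - rewrite horner_prod; apply: eq_bigr => m _.
    by rewrite !hornerE rmorphB rmorph_nat natrD /a; ring.
  - rewrite rmorph_prod; apply: eq_bigr => m _.
    by rewrite rmorphB /= -/y -ioE rmorphB rmorph_nat /a /d; ring.
  - rewrite horner_prod; apply: eq_bigr => m _.
    rewrite !hornerE rmorphB rmorph_nat natrD natr_pchar_sub //; last first.
      by case/andP: j0p => _ /ltnW.
    by rewrite /a /d; ring.
have size_Psi : (size Psi <= p.-1)%N.
  rewrite /Psi big_seq.
  apply: (big_ind (fun q : {poly K} => (size q <= p.-1)%N)) => [|q r sq sr|n].
  - by rewrite size_poly0.
  - by rewrite (leq_trans (size_polyD _ _)) // geq_max sq.
  rewrite mem_index_iota => /andP[n0 np].
  rewrite (leq_trans (size_scale_leq _ _)) // (leq_trans (size_polyD _ _)) //.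
  have szP f : (forall m, size (f m : {poly K}) <= 2)%N ->
      (size (\prod_(n.+1 <= m < p) f m)%R <= p.-1)%N.
    move=> sf; apply: leq_trans (size_prod_linear _ _ _ _ sf) _.
    by rewrite subnSK // -subn1 leq_sub2l.
  rewrite geq_max; apply/andP; split; apply: leq_trans (size_scale_leq _ _) _;
    apply: szP => m; first by rewrite size_XaddC.
  by rewrite -[_%:P - _]opprB size_polyN size_XsubC.
have Psi0 : Psi = 0.
  apply/eqP; apply: contraT => nz.
  (* These [p - 1] distinct roots exceed the degree, at most [p - 2]. *)
  pose rs := [seq y + j%:R | j <- iota 1 p.-1].
  suff : (size rs < size Psi)%N.
    by rewrite size_map size_iota ltnNge size_Psi.
  apply: (@max_poly_roots K Psi rs nz).
    apply/allP => _ /mapP[j + ->]; rewrite mem_iota add1n prednK //.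
    exact: Psi_root.
  rewrite map_inj_in_uniq ?iota_uniq // => m n.
  rewrite !mem_iota add1n prednK // => /andP[_ mp] /andP[_ np] /addrI.
  exact: (natr_pchar_inj _ _ pK).
have : Psi`_b = tofrac (\sum_(1 <= n < p)
   (c n * cosym u n.+1 p b) *: (T1 n + (-1) ^+ b *: T2 n)).
  rewrite /Psi coef_sum rmorph_sum; apply: eq_bigr => n _.
  rewrite coefZ coefD !coefZ coef_prod_CsubX -/(cosym _ n.+1 p b).
  rewrite (@cosym_morph _ _ io u) // -!mul_polyC !rmorphM rmorphD /=.
  rewrite !rmorphM /= -!ioE !rmorphXn !rmorphN1 /=; ring.
rewrite Psi0 coef0 => /esym/eqP; rewrite tofrac_eq0 => /eqP.
move/(congr1 (fun q : {poly F} => q`_i)); rewrite coef0 coef_sum => H.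
(* The two halves of [Psi] contribute [1 + (-1)^(i + b) = 2] times the sum. *)
apply: (mulfI (natr2_pchar_neq0 _ _ pF p_odd)).
rewrite mulr0 -[RHS]H big_distrr /=; apply: eq_bigr => n _.
rewrite coefZ coefD coefZ coef_prod_CsubX -/(cosym u 1 n i).
rewrite [(-1) ^+ b * _]mulrA -exprD.
rewrite -signr_odd addnC (negPf ib) expr0 mul1r /c.
ring.
Qed.

(** Over the fractions, [2(n - x)/(n - 2x) = 1 + n/(n - 2x)]: the 1 gives a single [cosym] by
    [cosym_split], the rest vanishes by parity. *)
Lemma sum_cosym_mark (F : fieldType) (p i b : nat) :
    p \in [pchar F] -> odd p -> ~~ odd (i + b) -> ((i + b).+1 < p)%N ->
  let u (m : nat) : {poly F} := m%:R - 'X in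
  let v (m : nat) : {poly F} := m%:R - 'X *+ 2 in
  \sum_(1 <= n < p) cosym u 1 n i * cosym u n.+1 p b * (u n *+ 2) *
     (\prod_(1 <= m < n) v m * \prod_(n.+1 <= m < p) v m)
  = (\prod_(1 <= m < p) v m) * 'X^(p.-1 - (i + b).+1).
Proof.
move=> pF p_odd ib ibp u v.
have p_gt0 : (0 < p)%N := prime_gt0 (pcharf_prime pF).
pose K := {fraction {poly F}}; pose x : K := tofrac ('X : {poly F}).
have pK : p \in [pchar K].
  by apply: (rmorph_pchar (@tofrac {poly F} \o @polyC F)%FUN).
have nx n : n%:R != x *+ 2.
  have -> : n%:R = tofrac (n%:R : {poly F}) by rewrite rmorph_nat.
  have -> : x *+ 2 = tofrac ('X *+ 2 : {poly F}) by rewrite rmorphMn.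
  rewrite tofrac_eq -polyC_natr.
  apply/eqP => /(congr1 (fun q : {poly F} => q`_1)).
  rewrite coefC coefMn coefX /= => /esym/eqP.
  by rewrite (negPf (natr2_pchar_neq0 _ _ pF p_odd)).
pose u' (m : nat) : K := m%:R - x.
have uE m : u' m = tofrac (u m) by rewrite rmorphB /= rmorph_nat.
have vE m : tofrac (v m) = m%:R - x *+ 2.
  by rewrite rmorphB /= rmorph_nat rmorphMn.
apply/eqP; rewrite -tofrac_eq; apply/eqP.
rewrite rmorph_sum rmorphM rmorphXn -/x /=.
have <- := cosym_natrB K p pK p_odd x (i + b).+1 ibp.
rewrite -(@cosym_split _ u') //.
rewrite -[X in _ * X]addr0 -[X in _ * (_ + X)](sum_cosym_even _ p x i b pK p_odd nx ib).
rewrite -big_split big_distrr /=; apply: eq_big_nat => n /andP[n0 np].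
rewrite (@big_cat_nat _ _ _ n 1 p) ?(ltnW np) //= [\prod_(n <= i0 < p) _]big_ltn //.
rewrite !rmorphM rmorphMn /= -!(@cosym_morph _ _ (@tofrac {poly F}) u u') //.
rewrite vE -uE; move: (nx n) => {}nx.
have mark_alg (L : fieldType) (y z s t q r : L) : y - z *+ 2 != 0 ->
    s * t * ((y - z) *+ 2) * (q * r)
    = q * ((y - z *+ 2) * r) * (s * t + y / (y - z *+ 2) * (s * t)).
  by move=> yz; field; rewrite mulr_natr.
by apply: mark_alg; rewrite subr_eq0.
Qed.

(** * Generating functions modulo ['X^(k+1)] *)

Lemma coef_prod_geom (R : comNzRingType) (k d : nat) (a : 'I_d -> R) :
  (\prod_(j < d) \sum_(1 <= c < k.+1) (a j *: 'X) ^+ c)`_k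
  = \sum_(c : {ffun 'I_d -> 'I_k.+1} | is_composition c)
      \prod_(j < d) a j ^+ c j.
Proof.
under eq_bigr => j _.
  rewrite (_ : \sum_(1 <= c < k.+1) _ =
     \sum_(c < k.+1 | (0 < c)%N) (a j *: 'X) ^+ c); last first.
    by rewrite big_geq_mkord.
  over.
rewrite bigA_distr_big_dep coef_sum /= [RHS]big_mkcond [LHS]big_mkcond /=.
apply: eq_bigr => c _.
have -> : (c \in family (fun _ : 'I_d => [pred m : 'I_k.+1 | 0 < m]%N))
          = [forall j, 0 < c j]%N by apply: eq_forallb.
rewrite /is_composition; case: [forall j, _] => //=.
under eq_bigr do rewrite exprZn.
rewrite scaler_prod prodrXr coefZ coefXn eq_sym.
by case: eqP => _; rewrite ?mulr1 ?mulr0.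
Qed.

(** The series [aX/(1 - aX)] cut after degree [k], so that it stays a polynomial. *)
Definition geom {R : comNzRingType} (k : nat) (a : R) : {poly R} :=
  \sum_(1 <= c < k.+1) (a *: 'X) ^+ c.

Lemma geom0 (R : comNzRingType) k : geom k (0 : R) = 0.
Proof.
rewrite /geom big_nat big1 // => c /andP[c0 _].
by rewrite scale0r expr0n gtn_eqF.
Qed.

(** The scalar [e] clears denominators: [e = m] with [a = 1/m] or [a = 2/m] gives the factor [m - X]
    or [m - 2X]. *)
Lemma mul_geom (R : comNzRingType) k (e a : R) :
  (e%:P - (e * a) *: 'X) * geom k a
  = (e * a) *: 'X - (e * a ^+ k.+1) *: 'X^(k.+1).
Proof.
elim: k => [|k IH]; first by rewrite /geom big_geq // mulr0 expr1 subrr.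
rewrite /geom big_nat_recr //= mulrDr -/(geom k a) IH -!mul_polyC.
rewrite !polyCM !rmorphXn /= [(a%:P * _) ^+ _]exprMn ['X^(k.+2)]exprS; ring.
Qed.

(** Here [f] models reduction modulo ['X^(k+1)]: under it the truncation errors of the geometric
    series disappear. *)
Lemma incsum_geom (F : fieldType) (A : comNzRingType)
    (f : {rmorphism {poly F} -> A}) (p k i b : nat) (w : nat -> nat -> {poly F}) :
    p \in [pchar F] -> odd p -> ~~ odd (i + b) -> ((i + b).+1 < p)%N ->
    f 'X^(k.+1) = 0 ->
    (forall m, w i m = geom k (2%:R / m%:R)) ->
    (forall j m, j != i -> w j m = geom k (m%:R^-1)) ->
  let u (m : nat) : {poly F} := m%:R - 'X in
  let v (m : nat) : {poly F} := m%:R - 'X *+ 2 in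
  f ((\prod_(1 <= m < p) v m) * ((\prod_(1 <= m < p) u m) * incsum w (i + b.+1) p))
  = f ((\prod_(1 <= m < p) v m) * 'X^(p.-1)).
Proof.
move=> pF p_odd ib ibp fX wi wj u v.
have p_gt0 : (0 < p)%N := prime_gt0 (pcharf_prime pF).
pose g (m : nat) : {poly F} := geom k (2%:R / m%:R).
pose h (m : nat) : {poly F} := geom k (m%:R^-1).
have geom_eq e a : f ((e%:P - (e * a) *: 'X) * geom k a) = f ((e * a) *: 'X).
  by rewrite mul_geom rmorphB -[X in _ - f X]mul_polyC rmorphM fX mulr0 subr0.
have fuh m : (0 < m < p)%N -> f (u m) * f (h m) = f 'X.
  move=> m0p; rewrite -rmorphM; have := geom_eq m%:R (m%:R^-1).
  by rewrite mulfV ?(natr_pchar_neq0 _ _ pF) // scale1r polyC_natr.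
have fvg m : (0 < m < p)%N -> f (v m) * f (g m) = f 'X *+ 2.
  move=> m0p; rewrite -rmorphM; have := geom_eq m%:R (2%:R / m%:R).
  rewrite [m%:R * _]mulrC divfK ?(natr_pchar_neq0 _ _ pF) // scaler_nat polyC_natr.
  by rewrite (rmorphMn f).
(* By the convention [0^-1 = 0], the index 0 contributes nothing and ranges may start at 1. *)
have h0 : h 0 = 0 by rewrite /h invr0 geom0.
have g0 : g 0 = 0 by rewrite /g invr0 mulr0 geom0.
have fe l n r : (0 < l <= n)%N -> (n <= p)%N ->
    f (\prod_(l <= m < n) u m) * f (elsym h l n r)
    = f 'X ^+ r * f (cosym u l n r).
  case/andP=> l0 ln np; rewrite elsym_morph rmorph_prod.
  rewrite (@prod_elsym _ (fun m => f (u m)) _ (f 'X)) //.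
    by rewrite (@cosym_morph _ _ f u).
  move=> m /andP[lm mn]; apply: fuh.
  by rewrite (leq_trans l0 lm) (leq_trans mn np).
rewrite (@incsum_mark _ w h g) // [\sum_(_ <= _ < _) _]big_ltn // g0 mulr0 mul0r add0r !big_distrr /=.
have := sum_cosym_mark F p i b pF p_odd ib ibp; rewrite -/u -/v /= => cm.
(* The indices before, at and after the mark supply [X^i], [X] and [X^b]. *)
transitivity (f ('X ^+ (i + b).+1 * (\prod_(1 <= m < p) v m * 'X^(p.-1 - (i + b).+1)))).
  rewrite -cm rmorphM rmorphXn !rmorph_sum big_distrr /=.
  apply: eq_big_nat => n /andP[n0 np].
  have split_prod (t : nat -> {poly F}) : \prod_(1 <= m < p) t m
      = \prod_(1 <= m < n) t m * (t n * \prod_(n.+1 <= m < p) t m).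
    by rewrite (@big_cat_nat _ _ _ n) ?(ltnW np) //= [\prod_(n <= m < p) _]big_ltn.
  rewrite (elsym_drop0 _ h) // (split_prod v) (split_prod u).
  have e1 := fe 1%N n i n0 (ltnW np); have e2 := fe n.+1 p b np (leqnn p).
  have e3 : f (v n) * f (g n) = f 'X *+ 2 by apply: fvg; rewrite n0.
  rewrite !(rmorphM f) (rmorphMn f) exprSr exprD.
  transitivity ((f (\prod_(1 <= m < n) u m) * f (elsym h 1 n i)) *
    (f (\prod_(n.+1 <= m < p) u m) * f (elsym h n.+1 p b)) *
    (f (v n) * f (g n)) * f (u n) *
    (f (\prod_(1 <= m < n) v m) * f (\prod_(n.+1 <= m < p) v m))); first by ring.
  by rewrite e1 e2 e3; ring.
congr (f _); rewrite mulrCA -exprD subnKC //.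
by rewrite -ltnS prednK.
Qed.

(** * From compositions to a congruence, and back to the coefficient *)

Lemma in_qpolyXn_eq (F : fieldType) k (q r : {poly F}) :
  in_qpoly 'X^(k.+1) q = in_qpoly 'X^(k.+1) r -> 'X^(k.+1) %| q - r.
Proof.
move=> /(congr1 val) /=.
rewrite /mk_monic size_polyXn monicXn /= -!Pdiv.IdomainMonic.modpE ?monicXn // => e.
by rewrite /dvdp modpD modpN e subrr.
Qed.

Lemma composition_sum_incsum (p k d : nat) (i : 'I_d) : prime p ->
  \sum_(c : {ffun 'I_d -> 'I_k.+1} | is_composition c)
     (2%:R : 'F_p) ^+ c i * Hp p (fun j => c j : nat)
  = (incsum (fun j m => geom k ((if j == i then 2%:R else 1) / m%:R : 'F_p)) d p)`_k.
Proof.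
move=> p_prime; rewrite -(incsum_ffun _ _ p) // coef_sum /Hp.
under eq_bigr do rewrite big_distrr /=.
(* [incsum] allows the value 0 where [Hp] does not; such tuples have a zero factor since
   [0^-1 = 0]. *)
rewrite exchange_big /= [RHS](bigID (fun n : {ffun 'I_d -> 'I_p} => [forall j, 0 < n j]%N)) /=.
rewrite [X in _ = _ + X]big1 ?addr0; last first.
  move=> n /andP[_]; rewrite negb_forall => /existsP[j]; rewrite lt0n negbK => /eqP nj.
  by rewrite (bigD1 j) //= nj invr0 mulr0 geom0 mul0r coef0.
apply: eq_big => [n|n _].
  rewrite andbC; congr (_ && _); rewrite -[LHS]andbT; congr (_ && _).
  by apply/esym/forallP => j.
rewrite coef_prod_geom; apply: eq_bigr => c _.
under [in RHS]eq_bigr do rewrite exprMn exprVn.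
rewrite big_split /=; congr (_ * _).
rewrite (bigD1 i) //= eqxx big1 ?mulr1 // => j ji.
by rewrite (inj_eq val_inj) (negPf ji) expr1n.
Qed.

(** Up to degree [k], [q] is [X^r/(X^r - 1) = -(X^r + X^(2r) + ...)]; comparing coefficients gives a
    recurrence with step [r]. *)
Lemma coef_periodic (R : nzRingType) (q : {poly R}) (r k : nat) : (0 < r)%N ->
    (forall l, (l <= k)%N -> (('X^r - 1) * q)`_l = ('X^r : {poly R})`_l) ->
  forall l, (0 < l <= k)%N -> q`_l = if (r %| l)%N then -1 else 0.
Proof.
move=> r0 H.
have q0 : q`_0 = 0.
  have := H 0 isT; rewrite mulrBl mul1r coefB coefXnM r0 coefXn ltn_eqF // sub0r.
  by move/eqP; rewrite oppr_eq0 => /eqP.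
elim/ltn_ind => l IH /andP[l0 lk].
have := H l lk; rewrite mulrBl mul1r coefB coefXnM coefXn => /eqP.
have [lr|rl] := ltnP l r.
  rewrite ltn_eqF // sub0r oppr_eq0 => /eqP ->.
  by rewrite ifN // gtnNdvd.
have [->|lr] := eqVneq l r; first by rewrite subnn q0 sub0r dvdnn eqr_oppLR => /eqP.
rewrite subr_eq0 => /eqP <-; rewrite IH.
- by rewrite dvdn_subl.
- by rewrite ltn_subrL r0.
- by rewrite subn_gt0 ltn_neqAle eq_sym lr rl (leq_trans (leq_subr _ _)).
Qed.

Theorem theorem1p1 (k d p : nat) (i : 'I_d)
    (k_gt0 : (0 < k)%N) (d_gt0 : (0 < d)%N) (d_odd : odd d)
    (p_prime : prime p) (p_odd : odd p) (d_lt_p : (d < p)%N) :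
  \sum_(c : {ffun 'I_d -> 'I_k.+1} | is_composition c)
     (2%:R : 'F_p) ^+ c i * Hp p (fun j => c j : nat)
  = if (p.-1 %| k)%N then -1 else 0.
Proof.
have pF : p \in [pchar 'F_p] := pchar_Fp p_prime.
rewrite composition_sum_incsum //; set w := fun j m => geom _ _.
pose b := (d - i.+1)%N.
have db : d = (i + b.+1)%N by rewrite /b -subSn ?subSS ?subnKC // ltnW.
have ib : ~~ odd (i + b) by move: d_odd; rewrite {1}db addnS.
have ibp : ((i + b).+1 < p)%N by rewrite -addnS -db.
have fX : in_qpoly ('X^(k.+1) : {poly 'F_p}) 'X^(k.+1) = 0.
  apply: val_inj; rewrite /= /mk_monic size_polyXn monicXn /=.
  by rewrite -Pdiv.IdomainMonic.modpE ?monicXn // modpp.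
have := @incsum_geom 'F_p _ (in_qpoly 'X^(k.+1)) p k i b w pF p_odd ib ibp fX _ _.
set u := fun m : nat => _ - 'X; set v := fun m : nat => _ - 'X *+ 2.
move=> /= H.
have {H} : 'X^(k.+1) %| (\prod_(1 <= m < p) v m) *
    (\prod_(1 <= m < p) u m * incsum w d p - 'X^(p.-1)).
  rewrite mulrBr; apply: in_qpolyXn_eq; rewrite db; apply: H.
    by move=> m; rewrite /w eqxx.
  by move=> j m ji; rewrite /w (negPf ji) mul1r.
(* The constant term [(p - 1)!] is nonzero, so this product cancels from the congruence. *)
have vX : coprimep ('X^(k.+1)) (\prod_(1 <= m < p) v m).
  apply: coprimep_expl; rewrite coprimep_sym coprimepX rootE horner_prod.
  rewrite prodf_seq_neq0; apply/allP => m; rewrite mem_index_iota => m0p.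
  rewrite /v -polyC_natr hornerD hornerN hornerMn hornerX hornerC mul0rn subr0.
  exact: (natr_pchar_neq0 _ _ pF).
rewrite Gauss_dvdpr //.
(* Restore the factor [-X] at [m = 0] to reach the full product [X - X^p]. *)
have -> : \prod_(1 <= m < p) u m = 'X^(p.-1) - 1.
  apply: (@mulfI _ (- 'X)); first by rewrite oppr_eq0 polyX_eq0.
  rewrite (prod1_natrB _ _ pF p_odd _ (@polyC 'F_p)) mulrBr mulr1 mulNr -exprS.
  by rewrite prednK ?prime_gt0 // opprK addrC.
move=> /dvdpP[q qE].
apply: (@coef_periodic _ _ _ k) => //.
- by rewrite -subn1 subn_gt0 prime_gt1.
- move=> l lk; apply/eqP; rewrite -subr_eq0 -coefB qE coefMXn ltnS lk //.
- by rewrite k_gt0 leqnn.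
Qed.
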